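(* Let $\bar x\in\mathbb{R}^n$ be a feasible point of the problem (MPVC). Suppose that $\bar x$ is an $A_\alpha$-stationary point of (MPVC) for all $\alpha\in\{0,1\}^p$. Then the following hold. (a) For each $i\in I^p$, let $C_i\subset(-\infty,0]^2$ be a closed, connected and unbounded set with $0\in C_i$. Then there exist multipliers $(\bar\eta,\bar\lambda,\bar\mu,\bar\nu)$ that satisfy the system of weak stationarity of (MPVC) at $\bar x$ and $$(\bar\mu_i=0\wedge\bar\nu_i\ge 0)\ \vee\ (-\bar\mu_i,\bar\nu_i)\in C_i\qquad\forall i\in I^{00}(\bar x).$$ (b) The point $\bar x$ is $P_d$-stationary for all $d\in[0,1]^p$. (c) The point $\bar x$ is $P_\alpha$-stationary for all $\alpha\in\{0,1\}^p$. In particular, these stationarity conditions (a), (b), (c) are satisfied for local minimizers $\bar x$ of (MPVC) if MPVC-GCQ holds at $\bar x$.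
   Context: Let $f:\mathbb{R}^n\to\mathbb{R}$, $g:\mathbb{R}^n\to\mathbb{R}^l$, $h:\mathbb{R}^n\to\mathbb{R}^m$, $G,H:\mathbb{R}^n\to\mathbb{R}^p$ be differentiable functions. The mathematical program with vanishing constraints (MPVC) is: minimize $f(x)$ over $x\in\mathbb{R}^n$ subject to $g(x)\le 0$, $h(x)=0$, and $H_i(x)\ge 0$, $G_i(x)H_i(x)\le 0$ for all $i\in\{1,\dots,p\}$. Index sets: $I^l=\{1,\dots,l\}$, $I^m=\{1,\dots,m\}$, $I^p=\{1,\dots,p\}$, $I^g(x)=\{i\in I^l: g_i(x)=0\}$, and, as subsets of $I^p$, $I^{+0}(x)=\{G_i(x)>0, H_i(x)=0\}$, $I^{0+}(x)=\{G_i(x)=0, H_i(x)>0\}$, $I^{-0}(x)=\{G_i(x)<0, H_i(x)=0\}$, $I^{-+}(x)=\{G_i(x)<0, H_i(x)>0\}$, $I^{00}(x)=\{G_i(x)=0, H_i(x)=0\}$; for $\alpha\in\{0,1\}^p$ and $c\in\{0,1\}$, $I^{00}_{\alpha=c}(x)=\{i\in I^{00}(x): \alpha_i=c\}$. Weak stationarity: multipliers $\bar\lambda\in\mathbb{R}^l$, $\bar\eta\in\mathbb{R}^m$, $\bar\mu,\bar\nu\in\mathbb{R}^p$ satisfy the system of weak stationarity at a feasible point $\bar x$ of (MPVC) if $$\nabla f(\bar x)+\sum_{i\in I^l}\bar\lambda_i\nabla g_i(\bar x)+\sum_{i\in I^m}\bar\eta_i\nabla h_i(\bar x)+\sum_{i\in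 I^p}\bar\mu_i\nabla G_i(\bar x)-\sum_{i\in I^p}\bar\nu_i\nabla H_i(\bar x)=0,$$ $\bar\lambda_i\ge 0$ for $i\in I^g(\bar x)$, $\bar\lambda_i=0$ for $i\in I^l\setminus I^g(\bar x)$, $\bar\mu_i=0$ for $i\in I^{+0}(\bar x)\cup I^{-0}(\bar x)\cup I^{-+}(\bar x)$, $\bar\mu_i\ge 0$ for $i\in I^{0+}(\bar x)\cup I^{00}(\bar x)$, $\bar\nu_i=0$ for $i\in I^{0+}(\bar x)\cup I^{-+}(\bar x)$, $\bar\nu_i\ge 0$ for $i\in I^{-0}(\bar x)$. For $\alpha\in\{0,1\}^p$ and $d\in[0,1]^p$, a feasible point $\bar x$ of (MPVC) is called - $A_\alpha$-stationary if there exist multipliers satisfying the system of weak stationarity together with $\bar\mu_i=0$ for all $i\in I^{00}_{\alpha=0}(\bar x)$ and $\bar\nu_i\ge 0$ for all $i\in I^{00}_{\alpha=1}(\bar x)$; - $P_\alpha$-stationary if there exist multipliers satisfying the system of weak stationarity together with $\bar\mu_i=0$ for all $i\in I^{00}_{\alpha=0}(\bar x)$ and $(\bar\mu_i=0\wedge\bar\nu_i\ge 0)\vee\bar\nu_i=0$ for all $i\in I^{00}_{\alpha=1}(\bar x)$; - $P_d$-stationary if there exist multipliers satisfying the system of weak stationarity together with $(\bar\mu_i=0\wedge\bar\nu_i\ge 0)\vee(1-d_i)\bar\mu_i=-d_i\bar\nu_i$ for all $i\in I^{00}(\bar x)$. Constraint qualification: the tangent cone to a closed set $F\subset\mathbb{R}^n$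 at $\bar x\in F$ is the set of all $d\in\mathbb{R}^n$ for which there are sequences $(x_k)\subset F$, $(t_k)\subset(0,\infty)$ with $x_k\to\bar x$, $t_k\downarrow 0$, $t_k^{-1}(x_k-\bar x)\to d$. Let $\mathcal{T}_{\rm MPVC}(\bar x)$ be the tangent cone to the feasible set of (MPVC) at $\bar x$, and let $\mathcal{T}_{\rm MPVC}^{\rm lin}(\bar x)$ be the set of all $d\in\mathbb{R}^n$ with $\nabla g_i(\bar x)^\top d\le 0$ for $i\in I^g(\bar x)$; $\nabla h_i(\bar x)^\top d=0$ for $i\in I^m$; $\nabla G_i(\bar x)^\top d\le 0$ for $i\in I^{0+}(\bar x)$; $\nabla H_i(\bar x)^\top d=0$ for $i\in I^{+0}(\bar x)$; $\nabla H_i(\bar x)^\top d\ge 0$ for $i\in I^{00}(\bar x)\cup I^{-0}(\bar x)$; $(\nabla G_i(\bar x)^\top d)(\nabla H_i(\bar x)^\top d)\le 0$ for $i\in I^{00}(\bar x)$. The polar cone of $C\subset\mathbb{R}^n$ is $C^\circ=\{d\in\mathbb{R}^n: d^\top y\le 0\ \forall y\in C\}$. A feasible point $\bar x$ satisfies MPVC-GCQ if $\mathcal{T}_{\rm MPVC}(\bar x)^\circ=\mathcal{T}_{\rm MPVC}^{\rm lin}(\bar x)^\circ$. *)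

(* Defs.v *)
From HB Require Import structures.
From mathcomp Require Import all_boot all_order all_algebra.
From mathcomp Require Import all_classical all_reals all_analysis.

Set Implicit Arguments.
Unset Strict Implicit.
Unset Printing Implicit Defensive.

Import Order.TTheory GRing.Theory Num.Theory.
Import numFieldNormedType.Exports.

Local Open Scope classical_set_scope.
Local Open Scope ring_scope.

(* The Euclidean inner product; the norm that the library puts on 'rV[R]_n is
   the sup norm, which induces the same topology and differentiability. *)
Definition dot (R : realType) (n : nat) (u v : 'rV[R]_n) : R :=
  \sum_(j < n) u 0 j * v 0 j.

Definition grad (R : realType) (n : nat) (phi : 'rV[R]_n -> R)
    (x : 'rV[R]_n) : 'rV[R]_n :=
  \row_(j < n) 'D_(delta_mx 0 j) phi x.

Definition comp_fun (R : realType) (n k : nat) (F : 'rV[R]_n -> 'rV[R]_k)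
    (i : 'I_k) : 'rV[R]_n -> R :=
  fun x => F x 0 i.

Definition tangent_cone (R : realType) (n : nat) (F : set 'rV[R]_n)
    (x : 'rV[R]_n) : set 'rV[R]_n :=
  [set d | exists (x_ : nat -> 'rV[R]_n) (t_ : nat -> R),
     [/\ forall k, F (x_ k),
         forall k, 0 < t_ k,
         x_ k @[k --> \oo] --> x,
         t_ k @[k --> \oo] --> (0 : R) &
         (t_ k)^-1 *: (x_ k - x) @[k --> \oo] --> d]].

Definition polar_cone (R : realType) (n : nat) (C : set 'rV[R]_n) :
    set 'rV[R]_n :=
  [set d | forall y, C y -> dot d y <= 0].

(* minimize f(x) subject to g(x) <= 0, h(x) = 0, and H_i(x) >= 0,
   G_i(x) H_i(x) <= 0 for every i < p *)
Record mpvc (R : realType) (n l m p : nat) := Mpvc {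
  fobj : 'rV[R]_n -> R;
  gcon : 'rV[R]_n -> 'rV[R]_l;
  hcon : 'rV[R]_n -> 'rV[R]_m;
  Gcon : 'rV[R]_n -> 'rV[R]_p;
  Hcon : 'rV[R]_n -> 'rV[R]_p
}.

Section MPVC.
Variables (R : realType) (n l m p : nat) (P : mpvc R n l m p).
Implicit Types (x : 'rV[R]_n) (alpha : {ffun 'I_p -> bool}).

Local Notation f := (fobj P).
Local Notation g_ := (comp_fun (gcon P)).
Local Notation h_ := (comp_fun (hcon P)).
Local Notation G_ := (comp_fun (Gcon P)).
Local Notation H_ := (comp_fun (Hcon P)).

Definition mpvc_differentiable : Prop :=
  [/\ forall x, differentiable f x,
      forall x, differentiable (gcon P) x,
      forall x, differentiable (hcon P) x,
      forall x, differentiable (Gcon P) x &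
      forall x, differentiable (Hcon P) x].

Definition feasible : set 'rV[R]_n :=
  [set x | [/\ forall i, g_ i x <= 0,
               forall i, h_ i x = 0,
               forall i, 0 <= H_ i x &
               forall i, G_ i x * H_ i x <= 0]].

Definition local_minimizer x : Prop :=
  feasible x /\ \forall y \near x, feasible y -> f x <= f y.

(* In the names of the index sets the first sign is that of G_i(x) and the
   second that of H_i(x): p for positive, n for negative, 0 for zero. *)
Definition Ig x : {set 'I_l} := [set i | g_ i x == 0]%SET.
Definition Ip0 x : {set 'I_p} := [set i | (0 < G_ i x) && (H_ i x == 0)]%SET.
Definition I0p x : {set 'I_p} := [set i | (G_ i x == 0) && (0 < H_ i x)]%SET.
Definition In0 x : {set 'I_p} := [set i | (G_ i x < 0) && (H_ i x == 0)]%SET.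
Definition Inp x : {set 'I_p} := [set i | (G_ i x < 0) && (0 < H_ i x)]%SET.
Definition I00 x : {set 'I_p} := [set i | (G_ i x == 0) && (H_ i x == 0)]%SET.
Definition I00_alpha alpha (c : bool) x : {set 'I_p} :=
  [set i in I00 x | alpha i == c]%SET.

Definition weak_stationarity_system x (lambda : 'rV[R]_l) (eta : 'rV[R]_m)
    (mu nu : 'rV[R]_p) : Prop :=
  [/\ grad f x
      + \sum_(i < l) lambda 0 i *: grad (g_ i) x
      + \sum_(i < m) eta 0 i *: grad (h_ i) x
      + \sum_(i < p) mu 0 i *: grad (G_ i) x
      - \sum_(i < p) nu 0 i *: grad (H_ i) x = 0,
      (forall i, i \in Ig x -> 0 <= lambda 0 i) /\
      (forall i, i \notin Ig x -> lambda 0 i = 0),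
      (forall i, i \in (Ip0 x :|: In0 x :|: Inp x)%SET -> mu 0 i = 0) /\
      (forall i, i \in (I0p x :|: I00 x)%SET -> 0 <= mu 0 i) &
      (forall i, i \in (I0p x :|: Inp x)%SET -> nu 0 i = 0) /\
      (forall i, i \in In0 x -> 0 <= nu 0 i)].

Definition Aalpha_stationary alpha x : Prop :=
  feasible x /\
  exists (lambda : 'rV[R]_l) (eta : 'rV[R]_m) (mu nu : 'rV[R]_p),
    [/\ weak_stationarity_system x lambda eta mu nu,
        forall i, i \in I00_alpha alpha false x -> mu 0 i = 0 &
        forall i, i \in I00_alpha alpha true x -> 0 <= nu 0 i].

Definition Palpha_stationary alpha x : Prop :=
  feasible x /\
  exists (lambda : 'rV[R]_l) (eta : 'rV[R]_m) (mu nu : 'rV[R]_p),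
    [/\ weak_stationarity_system x lambda eta mu nu,
        forall i, i \in I00_alpha alpha false x -> mu 0 i = 0 &
        forall i, i \in I00_alpha alpha true x ->
          (mu 0 i = 0 /\ 0 <= nu 0 i) \/ nu 0 i = 0].

Definition Pd_stationary (d : 'rV[R]_p) x : Prop :=
  feasible x /\
  exists (lambda : 'rV[R]_l) (eta : 'rV[R]_m) (mu nu : 'rV[R]_p),
    weak_stationarity_system x lambda eta mu nu /\
    forall i, i \in I00 x ->
      (mu 0 i = 0 /\ 0 <= nu 0 i) \/
      (1 - d 0 i) * mu 0 i = - d 0 i * nu 0 i.

Definition mpvc_tangent_cone x : set 'rV[R]_n := tangent_cone feasible x.

Definition mpvc_linearized_cone x : set 'rV[R]_n :=
  [set d |
    [/\ (forall i, i \in Ig x -> dot (grad (g_ i) x) d <= 0) /\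
        (forall i, dot (grad (h_ i) x) d = 0),
        forall i, i \in I0p x -> dot (grad (G_ i) x) d <= 0,
        forall i, i \in Ip0 x -> dot (grad (H_ i) x) d = 0,
        forall i, i \in (I00 x :|: In0 x)%SET -> 0 <= dot (grad (H_ i) x) d &
        forall i, i \in I00 x ->
          dot (grad (G_ i) x) d * dot (grad (H_ i) x) d <= 0]].

Definition mpvc_GCQ x : Prop :=
  feasible x /\
  polar_cone (mpvc_tangent_cone x) = polar_cone (mpvc_linearized_cone x).

End MPVC.

(* Main.v *)
Require Import Defs.
From HB Require Import structures.
From mathcomp Require Import all_boot all_order all_algebra.
From mathcomp Require Import all_classical all_reals all_analysis.
From mathcomp Require Import ring lra.

Set Implicit Arguments.
Unset Strict Implicit.
Unset Printing Implicit Defensive.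

Import Order.TTheory GRing.Theory Num.Theory.
Import numFieldNormedType.Exports.

(* For every alpha pick multipliers (mu^alpha, nu^alpha) witnessing
   A_alpha-stationarity, and for t in the cube [0,1]^p form their convex
   combination with the multilinear weights of the corners alpha. The system of
   weak stationarity is convex, so each combination satisfies it. The point
   z_i(t) = (-mu_i(t), nu_i(t)) lies in the half-plane of nonpositive abscissae;
   on the face t_i = 0 it is on the vertical axis, on the face t_i = 1 in the
   second quadrant. It is good if it lies in C_i or on the nonnegative vertical
   axis; the good points separate the second quadrant from the negative vertical
   axis, so a Poincare-Miranda argument yields t such that all z_i(t) are good.
   As C_i need not contain arcs, the argument is carried out in 2p variables
   (the t_i and points c_i of C_i, with the equations z_i(t) = c_i) and only uses
   that C_i contains finite chains with arbitrarily small steps from the origin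
   to far away.

   (b) is (a) for rays C_i, and (c) is (b) for d = alpha. At a local minimizer,
   GCQ gives -grad f in the polar of the linearized cone, which contains a
   polyhedral cone whose Farkas multipliers are those of A_alpha-stationarity. *)

Local Open Scope ring_scope.

(** * Cup products on a cubical grid with coefficients in ['F_2] *)

Section CubicalCupProduct.
Variables (d N : nat).
Local Notation point := ('I_d -> nat).
Implicit Types (q y : point) (s : seq 'I_d) (T : {set 'I_d}).

Definition upd q (i : 'I_d) a : point := fun k => if k == i then a else q k.
Definition incr q (i : 'I_d) : point := upd q i (q i).+1.

Lemma addFF (a : 'F_2) : a + a = 0.
Proof. by apply: (@addrr_pchar2 'F_2). Qed.

(** In characteristic 2 the terms for (i, k) and (k, i) cancel. The induction removes the row and
    the column of one element [j]. *)
Lemma F2_sumC_symm (I : finType) (D : {set I}) (g : I -> I -> 'F_2) :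
  (forall i k, i \in D -> k \in D :\ i -> g i k = g k i) ->
  \sum_(i in D) \sum_(k in D :\ i) g i k = 0.
Proof.
elim: {D}#|D| {-2}D (erefl #|D|) => [|c IHc] D cD gC.
  by move/eqP: cD; rewrite cards_eq0 => /eqP->; rewrite big_set0.
have /card_gt0P[j jD]: (0 < #|D|)%N by rewrite cD.
have cDj : #|D :\ j| = c by move: cD; rewrite (cardsD1 j) jD => -[].
rewrite (big_setD1 j) //=.
have -> : \sum_(i in D :\ j) \sum_(k in D :\ i) g i k =
    \sum_(i in D :\ j) (g j i + \sum_(k in (D :\ j) :\ i) g i k).
  apply: eq_bigr => i iDj; rewrite (big_setD1 j) /=; last first.
    by move: iDj; rewrite !inE eq_sym jD => /andP[->].
  congr (_ + _).
    by move: (iDj); rewrite inE => /andP[_ iD]; apply/esym/gC.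
  by apply: eq_bigl => k; rewrite !inE; case: (k == i); case: (k == j).
rewrite big_split /= addrA addFF add0r; apply: IHc => // i k.
rewrite !inE => /andP[ij iD] /and3P[ki kj kD]; apply: gC => //.
by rewrite !inE ki.
Qed.

Variable (lab : 'I_d -> point -> 'F_2).

(* The cubical cup product of the coboundaries of the labels lab j, j in s,
   evaluated on the cube with lowest corner q and edge directions T. *)
Fixpoint cup s T q : 'F_2 :=
  if s is j :: s' then
    \sum_(i in T) (lab j (incr q i) - lab j q) * cup s' (T :\ i) (incr q i)
  else 1.

Lemma incrC q (i k : 'I_d) : i != k -> incr (incr q i) k = incr (incr q k) i.
Proof.
move=> ik; apply/funext => j; rewrite /incr /upd.
rewrite (eq_sym k i) (negbTE ik).
by case: eqP => [->|//]; case: eqP => // ji; rewrite ji eqxx in ik.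
Qed.

(* The coboundary of such a cup product vanishes. *)
Lemma cup_closed s T q : #|T| = (size s).+1 ->
  \sum_(i in T) cup s (T :\ i) (incr q i) = \sum_(i in T) cup s (T :\ i) q.
Proof.
elim: s T q => [|j s IHs] T q cT //=.
have TDC (i k : 'I_d) : T :\ i :\ k = T :\ k :\ i by rewrite !finset.setDDl finset.setUC.
have cTi (i : 'I_d) : i \in T -> #|T :\ i| = (size s).+1.
  by move=> iT; move: cT; rewrite (cardsD1 i) iT => -[].
pose l := lab j.
have -> : \sum_(i in T) \sum_(k in T :\ i)
      (l (incr (incr q i) k) - l (incr q i)) *
        cup s (T :\ i :\ k) (incr (incr q i) k) =
    - \sum_(i in T) l (incr q i) * \sum_(k in T :\ i) cup s (T :\ i :\ k) (incr q i).
  under eq_bigr => i iT.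
    under eq_bigr do rewrite mulrBl; rewrite sumrB -mulr_sumr IHs ?cTi //; over.
  rewrite sumrB F2_sumC_symm ?sub0r // => i k iT; rewrite !inE => /andP[ki _].
  by rewrite incrC 1?eq_sym // TDC.
have -> : \sum_(i in T) \sum_(k in T :\ i)
      (l (incr q k) - l q) * cup s (T :\ i :\ k) (incr q k) =
    \sum_(i in T) \sum_(k in T :\ i) l (incr q k) * cup s (T :\ i :\ k) (incr q k).
  under eq_bigr => i iT.
    under eq_bigr do rewrite mulrBl; rewrite sumrB -mulr_sumr IHs ?cTi //.
    rewrite mulr_sumr; over.
  rewrite sumrB [X in _ - X]F2_sumC_symm ?subr0 // => i k iT _.
  by rewrite TDC.
apply/eqP; rewrite eq_sym -subr_eq0 opprK -big_split /=.
under eq_bigr do rewrite mulr_sumr -big_split /=.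
apply/eqP/F2_sumC_symm => i k _ _; rewrite addrC; congr (_ * _ + _ * _).
  by rewrite TDC.
by rewrite TDC.
Qed.

(** Discrete Stokes formula: as [cup s] is closed, the left side is the coboundary of the cochain
    [lab j * cup s], signs being immaterial modulo 2. *)
Lemma cup_stokes j s T q : #|T| = (size s).+1 ->
  cup (j :: s) T q =
  \sum_(i in T) (lab j (incr q i) * cup s (T :\ i) (incr q i)
                  + lab j q * cup s (T :\ i) q).
Proof.
move=> cT; rewrite /= big_split /= -mulr_sumr -cup_closed // mulr_sumr -big_split.
apply: eq_bigr => i _ /=; rewrite mulrBl; congr (_ + _).
by apply/eqP; rewrite eq_sym -subr_eq0 opprK addFF.
Qed.

(** The lowest corners of grid cubes have coordinates below [N]; [q] matters only through its
    coordinates outside [s]. *)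
Fixpoint boxsum s (F : point -> 'F_2) q : 'F_2 :=
  if s is j :: s' then \sum_(a < N) boxsum s' F (upd q j a) else F q.

Lemma eq_boxsum s F1 F2 q : F1 =1 F2 -> boxsum s F1 q = boxsum s F2 q.
Proof.
by move=> e; elim: s q => //= j s IHs q; apply: eq_bigr => a _.
Qed.

Lemma boxsum_sum s (I : finType) (D : {set I}) (F : I -> point -> 'F_2) q :
  boxsum s (fun y => \sum_(i in D) F i y) q = \sum_(i in D) boxsum s (F i) q.
Proof.
elim: s q => //= j s IHs q.
by rewrite exchange_big /=; apply: eq_bigr => a _.
Qed.

Lemma boxsumD s F1 F2 q :
  boxsum s (fun y => F1 y + F2 y) q = boxsum s F1 q + boxsum s F2 q.
Proof.
elim: s q => //= j s IHs q.
by rewrite -big_split; apply: eq_bigr => a _; exact: IHs.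
Qed.

Lemma boxsum_eq0 s F (Q : point -> Prop) q :
  (forall y j a, j \in s -> Q y -> Q (upd y j a)) -> (forall y, Q y -> F y = 0) ->
  Q q -> boxsum s F q = 0.
Proof.
move=> QU F0; elim: s QU q => [|j s IHs] QU q Qq /=; first exact: F0.
rewrite big1 // => a _; apply: IHs.
  by move=> y k b ks; apply: QU; rewrite inE ks orbT.
by apply: QU; rewrite ?mem_head.
Qed.

Lemma updC q (i j : 'I_d) a b : i != j -> upd (upd q i a) j b = upd (upd q j b) i a.
Proof.
move=> ij; apply/funext => k; rewrite /upd.
by case: eqP => [->|//]; case: eqP => // ji; rewrite ji eqxx in ij.
Qed.

Lemma boxsum_upd s F q i a : i \notin s ->
  boxsum s F (upd q i a) = boxsum s (fun y => F (upd y i a)) q.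
Proof.
elim: s q => //= j s IHs q; rewrite inE negb_or => /andP[ij iNs].
by apply: eq_bigr => b _; rewrite updC // IHs.
Qed.

(** Modulo 2 every inner layer orthogonal to the direction [i] is counted twice, so only the two
    outer faces remain. *)
Lemma boxsum_telescope s F q i : i \in s -> uniq s ->
  boxsum s (fun y => F (incr y i) + F y) q =
  boxsum (rem i s) F (upd q i N) + boxsum (rem i s) F (upd q i 0).
Proof.
elim: s q => //= j s IHs q; rewrite inE => /predU1P[->|ins] /andP[jNs us].
  rewrite eqxx; transitivity (\sum_(a < N)
      (boxsum s F (upd q j a.+1) + boxsum s F (upd q j a))).
    apply: eq_bigr => a _; rewrite !boxsum_upd //.
    rewrite -boxsumD; apply: eq_boxsum => y; congr (F _ + _).
    by apply/funext => k; rewrite /incr /upd eqxx; case: eqP.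
  have tel (u : nat -> 'F_2) M : \sum_(a < M) (u a.+1 + u a) = u M + u 0%N.
    elim: M => [|M IHM]; first by rewrite big_ord0 addFF.
    by rewrite big_ord_recr /= IHM addrCA [u M + _]addrC -addrA addFF addr0.
  exact: (tel (fun a => boxsum s F (upd q j a))).
have -> : (j == i) = false by apply/negP => /eqP ji; rewrite ji ins in jNs.
rewrite /= -big_split; apply: eq_bigr => a _; rewrite IHs //.
have ji : j != i by apply: contraNneq jNs => ->.
by rewrite !(updC _ _ _ ji).
Qed.

(** The whole cube has the same coordinate [i] as [q], so the label [i] is constant on it and its
    factor in [cup] vanishes. *)
Lemma cup_face s T q i : i \in s -> i \notin T ->
  (forall y y', y i = q i -> y' i = q i -> lab i y = lab i y') -> cup s T q = 0.
Proof.
move=> + + E; elim: s T q E => //= j s IHs T q E; rewrite inE => /predU1P[<-|ins] iNT.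
  rewrite big1 // => k kT; rewrite (E (incr q k) q) ?subrr ?mul0r //.
  by rewrite /incr /upd; case: eqP => // ik; rewrite ik kT in iNT.
rewrite big1 // => k kT; rewrite (IHs _ (incr q k)) ?mulr0 //.
  have -> : incr q k i = q i.
    by rewrite /incr /upd; case: eqP => // ik; rewrite ik kT in iNT.
  exact: E.
by rewrite inE negb_and iNT orbT.
Qed.

(** By Stokes the sum moves to the boundary of the box. The label [j] is 0 on one face orthogonal to
    [j] and 1 on the other, which leaves the same sum in one dimension less; on faces orthogonal to
    another [i] the label [i] is constant and [cup_face] applies. *)
Lemma boxsum_cup s q : uniq s ->
  (forall i y, i \in s -> y i = 0%N -> lab i y = 0) ->
  (forall i y, i \in s -> y i = N -> lab i y = 1) ->
  boxsum s (cup s [set i in s]) q = 1.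
Proof.
elim: s q => //= j s IHs q /andP[jNs us] l0 l1.
have cs : #|[set i in j :: s]| = (size s).+1.
  by rewrite cardsE; apply/card_uniqP; rewrite /= jNs.
pose phi i y := lab j y * cup s ([set i in j :: s] :\ i) y.
transitivity (boxsum (j :: s)
    (fun y => \sum_(i in [set i in j :: s]) (phi i (incr y i) + phi i y)) q).
  by apply: (@eq_boxsum (j :: s)) => y; rewrite -cup_stokes.
rewrite boxsum_sum.
have Tj : [set i in j :: s] :\ j = [set i in s].
  by apply/setP => k; rewrite !inE; case: eqP => // ->; rewrite (negbTE jNs).
rewrite (big_setD1 j) ?inE ?eqxx // Tj -[LHS]/(_ + _).
rewrite boxsum_telescope ?mem_head //; last by rewrite /= jNs.
have -> : rem j (j :: s) = s by rewrite /= eqxx.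
have -> : boxsum s (phi j) (upd q j 0) = 0.
  apply: (@boxsum_eq0 _ _ (fun y => y j = 0%N)).
  - by move=> y k a ks yj; rewrite /upd; case: eqP => // jk; rewrite jk ks in jNs.
  - by move=> y yj; rewrite /phi l0 ?mem_head ?mul0r.
  - by rewrite /upd eqxx.
rewrite addr0 [X in _ + X]big1 ?addr0; last first.
  move=> i; rewrite inE => ins.
  rewrite boxsum_telescope ?inE ?ins ?orbT //; last by rewrite /= jNs.
  have ij : j == i = false by apply/negP => /eqP ji; rewrite ji ins in jNs.
  have U a : (a = 0%N \/ a = N) -> boxsum (j :: rem i s) (phi i) (upd q i a) = 0.
    move=> aE; apply: (@boxsum_eq0 _ _ (fun y => y i = a)).
    - move=> y k b; rewrite inE /upd => kE yi; case: eqP => // ik; move: kE.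
      by rewrite -ik eq_sym ij /= mem_rem_uniq // inE eqxx.
    - move=> y yi; rewrite /phi (@cup_face _ _ _ i) ?mulr0 //.
        by rewrite !inE eqxx.
      move=> z z'; rewrite yi => zi z'i; case: aE => aE.
        by rewrite !l0 ?inE ?ins ?orbT // -aE.
      by rewrite !l1 ?inE ?ins ?orbT // -aE.
    - by rewrite /upd eqxx.
  have -> : rem i (j :: s) = j :: rem i s by rewrite /= ij.
  by have -> := U _ (or_introl erefl); have -> := U _ (or_intror erefl); rewrite addr0.
rewrite boxsum_upd //; under eq_boxsum.
  move=> y; rewrite /phi l1 ?mem_head //; last by rewrite /upd eqxx.
  rewrite mul1r Tj; over.
rewrite -boxsum_upd //; apply: IHs => // i y ins yi.
  by apply: l0; rewrite // inE ins orbT.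
by apply: l1; rewrite // inE ins orbT.
Qed.

Lemma sum_neq0 (I : finType) (D : pred I) (g : I -> 'F_2) :
  \sum_(i | D i) g i != 0 -> exists2 i, D i & g i != 0.
Proof.
case: (pickP (fun i => D i && (g i != 0))) => [i /andP[Di gi] _|g0]; first by exists i.
rewrite big1 ?eqxx // => i Di; apply/eqP.
by have := g0 i; rewrite Di => /negbFE.
Qed.

Lemma boxsum_neq0 s F q : boxsum s F q != 0 ->
  exists y, [/\ F y != 0, forall i, i \in s -> (y i < N)%N &
                forall i, i \notin s -> y i = q i].
Proof.
elim: s q => [|j s IHs] q /=; first by exists q.
move=> /sum_neq0[a _ /IHs[y [Fy ys yNs]]]; exists y; split=> // i.
  rewrite inE; have [/ys //|iNs] := boolP (i \in s).
  by rewrite orbF yNs // /upd => ->.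
by rewrite inE negb_or => /andP[/negbTE ij /yNs->]; rewrite /upd ij.
Qed.

(** A nonzero term of the expanded product is a monotone path of edges from [q]; each label of [s]
    changes along one of them. *)
Lemma cup_neq0 s T q : cup s T q != 0 -> forall i, i \in s ->
  exists y k, [/\ forall j, (q j <= y j)%N,
                  forall j, (y j <= incr y k j)%N,
                  forall j, (incr y k j <= q j + (j \in T))%N &
                  lab i (incr y k) != lab i y].
Proof.
elim: s T q => //= j s IHs T q /sum_neq0[k kT].
rewrite mulf_eq0 negb_or subr_eq0 => /andP[lk ck] i; rewrite inE.
have le_incr z m e : (z e <= incr z m e)%N.
  by rewrite /incr /upd; case: eqP => [->|].
have [->|_ /= ins] := eqVneq i j; last first.
  have [y [m [qy yy yq ly]]] := IHs _ _ ck _ ins.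
  exists y, m; split=> // e; first exact: leq_trans (le_incr _ _ _) (qy e).
  apply: leq_trans (yq e) _; rewrite !inE /incr /upd.
  by case: eqP => [->|_] /=; rewrite ?kT ?addn0 ?addn1.
exists q, k; split=> // e.
by rewrite /incr /upd; case: eqP => [->|_]; rewrite ?kT ?addn1 ?leq_addr.
Qed.
End CubicalCupProduct.

(* Kuhn's cubical form of Sperner's lemma: the cup product of the coboundaries
   of the labels sums to 1 over the grid, hence it is nonzero on some cube. *)
Lemma kuhn_cube (d N : nat) (lab : 'I_d -> ('I_d -> nat) -> bool) :
  (forall i y, y i = 0%N -> lab i y = false) ->
  (forall i y, y i = N -> lab i y = true) ->
  exists q : 'I_d -> nat, (forall j, (q j < N)%N) /\
    forall i, exists y y' : 'I_d -> nat,
      [/\ forall j, (q j <= y j <= (q j).+1)%N,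
          forall j, (q j <= y' j <= (q j).+1)%N, ~~ lab i y & lab i y'].
Proof.
move=> lab0 labN; pose l i y : 'F_2 := (lab i y)%:R.
have := @boxsum_cup d N l (enum 'I_d) (fun=> 0%N) (enum_uniq _).
rewrite /l => /(_ _ _)/wrap[].
- by move=> i y _ /lab0->.
- by move=> i y _ /labN->.
move=> S1; have /boxsum_neq0[q [cq qN _]] :
    boxsum N (enum 'I_d) (cup l (enum 'I_d) [set i in enum 'I_d]%SET) (fun=> 0%N) != 0.
  by rewrite S1 oner_neq0.
exists q; split=> [j|i]; first by rewrite qN ?mem_enum.
have [|y [k [qy yy yq]]] := cup_neq0 cq (i := i); first by rewrite mem_enum.
have {}yq j : (incr y k j <= (q j).+1)%N.
  by apply: leq_trans (yq j) _; rewrite inE mem_enum addn1.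
rewrite /l; case E: (lab i y); case E': (lab i (incr y k)); rewrite ?eqxx // => _.
- exists (incr y k), y; split => [j|j||]; rewrite ?E ?E' //.
    by rewrite (leq_trans (qy j) (yy j)) yq.
  by rewrite qy (leq_trans (yy j)).
- exists y, (incr y k); split => [j|j||]; rewrite ?E ?E' //.
    by rewrite qy (leq_trans (yy j)).
  by rewrite (leq_trans (qy j) (yy j)) yq.
Qed.

(** * A Poincare-Miranda theorem along finite chains *)

HB.saturate prod.

Local Open Scope classical_set_scope.
Local Open Scope ring_scope.

(** The sequence is constant from [N] on, so that chains of different lengths can be indexed by one
    grid. *)
Definition chain (R : realType) (T : pseudoMetricType R) (X : set T) (e : R)
    (a b : T) (N : nat) (c : nat -> T) : Prop :=
  [/\ c 0%N = a, forall k, (N <= k)%N -> c k = b, forall k, X (c k) &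
      forall k, ball (c k) e (c k.+1)].

(* A version of the Poincare-Miranda theorem in which the edges of the cube are
   replaced by sets X i that need not contain arcs. *)
Lemma chain_poincare_miranda (R : realType) (T : pseudoPMetricType R) (d : nat)
    (X A B : 'I_d -> set T) (F : 'I_d -> 'rV[T]_d -> R) :
  (forall i, compact (X i)) ->
  (forall i (e : R), 0 < e ->
     exists N c a b, [/\ A i a, B i b & chain (X i) e a b N c]) ->
  (forall i, continuous (F i)) ->
  (forall i (x : 'rV[T]_d), (forall j, X j (x 0 j)) -> A i (x 0 i) -> F i x <= 0) ->
  (forall i (x : 'rV[T]_d), (forall j, X j (x 0 j)) -> B i (x 0 i) -> 0 <= F i x) ->
  exists x : 'rV[T]_d, (forall i, X i (x 0 i)) /\ forall i, F i x = 0.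
Proof.
move=> cX chX cF FA FB; apply: contrapT => nF.
pose K := [set x : 'rV[T]_d | forall i, X i (x 0 i)].
have cK : compact K by exact: rV_compact.
(* Some component of [F] keeps a strict sign on the ball of radius [e] about [x]. In the absence of
   a zero, compactness yields one [e] for all of [K]. *)
pose Q (e : R) (x : 'rV[T]_d) := exists i,
  (forall y, ball x e y -> 0 < F i y) \/ (forall y, ball x e y -> F i y < 0).
have : \forall e \near 0^'+, K `<=` Q e.
  move/compact_near_coveringP : cK; apply => x Kx.
  have [i Fi0] : exists i, F i x != 0.
    apply: contrapT => /forallNP F0; apply: nF; exists x; split=> // i.
    by apply/eqP/negP => /negP; exact: F0.
  have [e e0 eQ] : exists2 e : R, 0 < e & Q e x.
    have [Fi|Fi] := ltrP 0 (F i x).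
      have /nbhs_ballP[e /= e0 eP] := cF i x _ (lt_nbhsr Fi).
      by exists e => //; exists i; left=> y /eP.
    have {}Fi : F i x < 0 by rewrite lt_neqAle Fi0.
    have /nbhs_ballP[e /= e0 eP] := cF i x _ (lt_nbhsl Fi).
    by exists e => //; exists i; right=> y /eP.
  exists (ball x (e / 2), [set r | r < e / 2]) => /=.
    split; first by apply: nbhsx_ballx; rewrite divr_gt0.
    by apply: nbhs_right_lt; rewrite divr_gt0.
  move=> [x' r] /= [xx' re].
  have sub y : ball x' r y -> ball x e y.
    by move=> x'y; apply: (ball_split xx'); apply: le_ball x'y; exact: ltW.
  by case: eQ => j [] H; exists j; [left|right] => y /sub /H.
move=> KQ; have [e [e0 {}KQ]] : exists e : R, 0 < e /\ K `<=` Q e.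
  have : \forall e \near 0^'+, 0 < e /\ K `<=` Q e.
    by near=> e; split; near: e => //; exact: nbhs_right_gt.
  by move/filter_ex.
have [|t tP] := @boolp.choice _ _ (fun i (u : nat * (nat -> T) * (T * T)) =>
    [/\ A i u.2.1, B i u.2.2 & chain (X i) e u.2.1 u.2.2 u.1.1 u.1.2]).
  by move=> i; have [N [c [a [b H]]]] := chX i _ e0; exists ((N, c), (a, b)).
pose c i := (t i).1.2.
(* A bound for all chain lengths; the successor keeps it nonzero, so that the labels prescribed on
   opposite faces do not clash. *)
pose N := (\sum_(i < d) (t i).1.1).+1.
have c0 i : A i (c i 0%N) by have [Aa _ [c0 _ _ _]] := tP i; rewrite /c c0.
have cN i : B i (c i N).
  have [_ Bb [_ cN _ _]] := tP i; rewrite /c cN //.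
  by apply/leqW; rewrite (bigD1 i) //= leq_addr.
have cX' i k : X i (c i k) by have [_ _ [_ _ H _]] := tP i; exact: H.
have cball i k : ball (c i k) e (c i k.+1) by have [_ _ [_ _ _ H]] := tP i; exact: H.
pose pt (y : 'I_d -> nat) : 'rV[T]_d := \row_i c i (y i).
have ptK y : K (pt y) by move=> i; rewrite mxE.
(* The sign of [F i], overridden on the faces by the labels of Kuhn's lemma; [FA] and [FB] make
   these agree with weak signs. *)
pose lab i y := (y i == N) || ((y i != 0%N) && (0 < F i (pt y))).
have [i y yi|i y yi|q [_ qP]] := @kuhn_cube d N lab.
- by rewrite /lab yi.
- by rewrite /lab yi eqxx.
have qball y : (forall j, (q j <= y j <= (q j).+1)%N) -> ball (pt q) e (pt y).
  move=> qy; split=> // i j; rewrite !mxE.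
  have := qy j; rewrite leq_eqVlt => /andP[/predU1P[<- _|qj yj]]; first exact: ballxx.
  by have -> : y j = (q j).+1 by apply/eqP; rewrite eqn_leq yj.
(* The cube lies in the ball of radius [e] about [pt q], where some [F i] has a strict sign; two of
   its vertices contradict this. *)
have [i H] := KQ _ (ptK q).
have [y [y' [/qball qy /qball qy' ly ly']]] := qP i.
have Fy : F i (pt y) <= 0.
  have [yi|yi] := eqVneq (y i) 0%N.
    by apply: FA => [j|]; [exact: ptK | rewrite mxE yi].
  by move: ly; rewrite /lab yi negb_or -leNgt => /andP[].
have Fy' : 0 <= F i (pt y').
  have [yi|yi] := eqVneq (y' i) N.
    by apply: FB => [j|]; [exact: ptK | rewrite mxE yi].
  by move: ly'; rewrite /lab (negbTE yi) => /andP[_ /ltW].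
by case: H => H; [have := H _ qy | have := H _ qy']; rewrite ltNge ?Fy ?Fy'.
Unshelve. all: by end_near. Qed.

(** * Finite chains in connected sets *)

(** The points reachable from [a] form a nonempty subset that is open and closed in [C], because a
    point of [C] within [e] of a reachable one is reachable. *)
Lemma connected_chain (R : realType) (T : pseudoMetricType R) (C : set T)
    (e : R) (a b : T) :
  connected C -> 0 < e -> C a -> C b -> exists N c, chain C e a b N c.
Proof.
move=> conC e0 Ca Cb.
pose D := [set x | C x /\ exists N c, chain C e a x N c].
have Da : D a by split=> //; exists 0%N, (fun=> a); split=> // k; exact: ballxx.
have step x y : D x -> C y -> ball x e y -> D y.
  move=> [_ [N [c [c0 cN Cc cc]]]] Cy xy; split=> //.
  exists N.+1, (fun k => if (k <= N)%N then c k else y); split=> //.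
  - by move=> k Nk; rewrite leqNgt Nk.
  - by move=> k; case: ifP.
  - move=> k; have [kN|Nk|->] := ltngtP k N.
    + exact: cc.
    + exact: ballxx.
    + by rewrite cN.
have : D = C.
  apply: conC; first by exists a.
  - exists (\bigcup_(x in D) (ball x e)°).
      by apply: bigcup_open => x _; exact: open_interior.
    apply/seteqP; split=> [x Dx|x [Cx [y Dy]]].
      split; first by case: Dx.
      by exists x => //; apply: nbhsx_ballx.
    by move=> /interior_subset; exact: step.
  - exists (~` \bigcup_(x in C `\` D) (ball x e)°).
      by apply: open_closedC; apply: bigcup_open => x _; exact: open_interior.
    apply/seteqP; split=> [x Dx|x [Cx nx]].
      split; first by case: Dx.
      move=> [y [Cy nDy]] /interior_subset /ball_sym yx; apply: nDy.
      exact: step yx.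
    apply: contrapT => nDx; apply: nx; exists x => //.
    exact: nbhsx_ballx.
by move=> DC; have [] : D b by rewrite DC.
Qed.

(** In the third quadrant [- z.1 - z.2] is the l^1 norm. The chain is cut at its first point of norm
    at least [M]; steps below 1 in each coordinate raise the norm by less than 2, so the chain stays
    in a bounded piece of [C]. *)
Lemma third_quadrant_chain (R : realType) (C : set (R * R)) (M e : R) :
  C `<=` `]-oo, 0] `*` `]-oo, 0] -> connected C -> ~ bounded_set C -> C (0, 0) ->
  0 < M -> 0 < e ->
  exists N c b, M <= - b.1 - b.2 /\
    chain (C `&` [set z | - z.1 - z.2 <= M + 2]) e (0, 0) b N c.
Proof.
move=> Cq conC unbC C0 M0 e0.
have [z Cz Mz] : exists2 z, C z & M <= - z.1 - z.2.
  apply: contrapT => /forall2NP nz; apply: unbC.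
  exists M; split; first exact: num_real.
  move=> M' MM' z Cz; have [//|/negP] := nz z; rewrite -ltNge => zM.
  have := Cq _ Cz; rewrite /= !in_itv /= => -[z1 z2].
  rewrite prod_normE /= ge_max !ler0_norm //; apply/andP; split; lra.
have e1 : 0 < Num.min e 1 by rewrite lt_min e0 ltr01.
have [N [c [c0 cN Cc cc]]] := connected_chain conC e1 C0 Cz.
have exM : exists k, M <= - (c k).1 - (c k).2 by exists N; rewrite cN.
case: (ex_minnP exM) => n Mn nmin.
exists n, (fun k => c (minn k n)), (c n); split=> //; split.
- by rewrite min0n.
- by move=> k nk; rewrite (minn_idPr nk).
- move=> k; split; first exact: Cc.
  rewrite /=; have [kn|nk] := ltnP k n.
    rewrite leNgt; apply/negP => kM.
    by have : (n <= k)%N by [apply: nmin; lra]; rewrite leqNgt kn.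
  case: n Mn nmin nk => [|n] Mn nmin nk; first by move: Mn; rewrite c0 /=; lra.
  have : ~ M <= - (c n).1 - (c n).2 by move=> /nmin; rewrite ltnn.
  have near1 (u v : R) : ball u (Num.min e 1) v -> u - 1 < v.
    by rewrite -ball_normE /= lt_min => /andP[_]; rewrite ltr_distlC => /andP[].
  have [/near1 + /near1] := cc n; lra.
- move=> k; have [kn|nk] := ltnP k n.
    rewrite (minn_idPl kn).
    by apply: le_ball (cc k); rewrite ge_min lexx.
  by rewrite (minn_idPr (leqW nk)); exact: ballxx.
Qed.

(** The interval is placed in the plane so that the parameters t_i have the same type as the points
    c_i. *)
Lemma unit_interval_chain (R : realType) (e : R) : 0 < e ->
  exists N c, chain (`[0 : R, 1] `*` [set (0 : R)]) e (0, 0) (1, 0) N c.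
Proof.
move=> e0.
have [||||N [c [c0 cN Xc cc]]] := @connected_chain R R `[0, 1] e 0 1.
- by apply/connected_intervalP; exact: interval_is_interval.
- exact: e0.
- by rewrite /= in_itv /= lexx ler01.
- by rewrite /= in_itv /= lexx ler01.
exists N, (fun k => (c k, 0)); split=> //=.
- by rewrite c0.
- by move=> k /cN->.
- by move=> k; split=> //; exact: Xc.
- by move=> k; split; [exact: cc | exact: ballxx].
Qed.

(** * Multilinear weights of the corners of the cube *)

(** For [t] in the cube, the probability of [alpha] when its entries are independent and [alpha i]
    is true with probability [t i]. *)
Definition corner_weight (R : realType) (p : nat) (t : 'I_p -> R)
    (alpha : {ffun 'I_p -> bool}) : R :=
  \prod_(i < p) (if alpha i then t i else 1 - t i).

Lemma corner_weight_sum (R : realType) (p : nat) (t : 'I_p -> R) :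
  \sum_alpha corner_weight t alpha = 1.
Proof.
rewrite -(bigA_distr_bigA (fun i (b : bool) => if b then t i else 1 - t i)).
by rewrite big1 // => i _; rewrite big_bool /= addrC subrK.
Qed.

Lemma corner_weight_ge0 (R : realType) (p : nat) (t : 'I_p -> R) alpha :
  (forall i, 0 <= t i <= 1) -> 0 <= corner_weight t alpha.
Proof.
move=> t01; apply: prodr_ge0 => i _; have /andP[t0 t1] := t01 i.
by case: ifP => // _; rewrite subr_ge0.
Qed.

Lemma corner_weight_le1 (R : realType) (p : nat) (t : 'I_p -> R) alpha :
  (forall i, 0 <= t i <= 1) -> corner_weight t alpha <= 1.
Proof.
move=> t01; rewrite -(corner_weight_sum t) (bigD1 alpha) //= lerDl.
by apply: sumr_ge0 => b _; exact: corner_weight_ge0.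
Qed.

Lemma corner_weight_face (R : realType) (p : nat) (t : 'I_p -> R) (b : bool)
    (alpha : {ffun 'I_p -> bool}) i :
  t i = b%:R -> alpha i != b -> corner_weight t alpha = 0.
Proof.
move=> ti ai; rewrite /corner_weight (bigD1 i) //= ti.
by move: ai; case: (alpha i); case: b {ti} => //=; rewrite ?subrr mul0r.
Qed.

(** * Continuity of the functions built from the weights *)

Lemma entry_continuous (R : realType) (T : pseudoMetricType R) (m n : nat)
    (i : 'I_m) (j : 'I_n) : continuous (fun x : 'M[T]_(m, n) => x i j).
Proof.
move=> x A /= /nbhs_ballP[e e0 eA].
by apply/nbhs_ballP; exists e => // y [_ xy]; exact/eA/xy.
Qed.

Lemma continuousD_fun (R : realType) (T : topologicalType) (f g : T -> R) :
  continuous f -> continuous g -> continuous (fun x => f x + g x).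
Proof. by move=> cf cg x; apply: cvgD; [exact: cf | exact: cg]. Qed.

Lemma continuousM_fun (R : realType) (T : topologicalType) (f g : T -> R) :
  continuous f -> continuous g -> continuous (fun x => f x * g x).
Proof. by move=> cf cg x; apply: cvgM; [exact: cf | exact: cg]. Qed.

Lemma continuousN_fun (R : realType) (T : topologicalType) (f : T -> R) :
  continuous f -> continuous (fun x => - f x).
Proof. by move=> cf x; apply: cvgN; exact: cf. Qed.

Lemma continuous_norm_fun (R : realType) (T : topologicalType) (f : T -> R) :
  continuous f -> continuous (fun x => `|f x|).
Proof. by move=> cf x; apply: cvg_norm; exact: cf. Qed.

Lemma continuous_min_fun (R : realType) (T : topologicalType) (f g : T -> R) :
  continuous f -> continuous g -> continuous (fun x => Num.min (f x) (g x)).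
Proof.
move=> cf cg.
under eq_fun do rewrite minr_absE.
apply: continuousM_fun; last exact: cst_continuous.
apply: continuousD_fun; first exact: continuousD_fun.
apply: continuousN_fun; apply: continuous_norm_fun; apply: continuousD_fun => //.
exact: continuousN_fun.
Qed.

Lemma continuous_corner_weight (R : realType) (p : nat) (T : topologicalType)
    (t : T -> 'I_p -> R) alpha :
  (forall i, continuous (t^~ i)) -> continuous (fun x => corner_weight (t x) alpha).
Proof.
move=> ct; rewrite /corner_weight.
apply: (@continuous_big R 'I_p *%R 1 xpredT (@mul_continuous R)) => i _.
case: (alpha i); first exact: ct.
by apply: continuousD_fun; [exact: cst_continuous | apply: continuousN_fun; exact: ct].
Qed.

Lemma continuous_sum_fun (R : realType) (I : finType) (T : topologicalType)
    (f : I -> T -> R) :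
  (forall i, continuous (f i)) -> continuous (fun x => \sum_i f i x).
Proof.
move=> cf; apply: (@continuous_big R I +%R 0 xpredT (@add_continuous R)) => i _.
exact: cf.
Qed.

(** * The crossing argument in 2p variables *)

(** Parallel vectors of the third quadrant with equal l^1 norm coincide. If [r] is positive, so is
    [mu], and parallelism forces [a = b = 0], against the norms. *)
Lemma parallel_eq (R : realType) (a b mu r : R) :
  a <= 0 -> b <= 0 -> 0 <= mu -> r <= mu ->
  - (mu * b) - r * a = 0 -> - a - b = mu + `|r| -> mu = - a /\ r = b.
Proof.
move=> a0 b0 mu0 rmu par len.
have [r0|r0] := lerP r 0.
  rewrite ler0_norm // in len.
  have [v0|v0] := eqVneq (- a - b) 0; first by split; lra.
  have e : (mu + a) * (- a - b) = 0.
    transitivity (- (mu * b) - r * a + a * ((- a - b) - (mu - r))); first by ring.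
    by rewrite par len; ring.
  by move/eqP: e; rewrite mulf_eq0 (negbTE v0) orbF => /eqP e; split; lra.
rewrite gtr0_norm // in len.
have ra : 0 <= - (r * a) by rewrite -mulrN mulr_ge0 ?oppr_ge0 // ltW.
have mb : 0 <= - (mu * b) by rewrite -mulrN mulr_ge0 ?oppr_ge0.
have /eqP : r * a = 0 by lra.
rewrite mulf_eq0 gt_eqF //= => /eqP a00.
have /eqP : mu * b = 0 by lra.
by rewrite mulf_eq0 => /orP[] /eqP; lra.
Qed.

Lemma min_norm_le (R : realType) (u v : R) : 0 <= u -> `|Num.min v u| <= u + `|v|.
Proof.
move=> u0; rewrite /Num.min; case: ifP => _; first by rewrite lerDr.
by rewrite (ger0_norm u0) lerDl.
Qed.

(* With r_i = min (nu_i, mu_i) in place of nu_i, the point (-mu_i, r_i) is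
   unchanged in the third quadrant, the positive vertical axis collapses to the
   origin, and the rest of the open second quadrant stays away from C_i. The
   components of F express that (-mu_i, r_i) and a point c_i of C_i are parallel
   and have the same l^1 norm, so that they are equal. *)
Lemma corner_crossing (R : realType) (p : nat) (C : 'I_p -> set (R * R))
    (mu nu : {ffun 'I_p -> bool} -> 'I_p -> R) :
  (forall i, [/\ C i `<=` `]-oo, 0] `*` `]-oo, 0], closed (C i), connected (C i),
                 ~ bounded_set (C i) & C i (0, 0)]) ->
  (forall alpha i, 0 <= mu alpha i) ->
  (forall (alpha : {ffun 'I_p -> bool}) i, alpha i = false -> mu alpha i = 0) ->
  (forall (alpha : {ffun 'I_p -> bool}) i, alpha i = true -> 0 <= nu alpha i) ->
  exists w : {ffun 'I_p -> bool} -> R,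
    [/\ forall alpha, 0 <= w alpha, \sum_alpha w alpha = 1 &
        forall i, let m := \sum_alpha w alpha * mu alpha i in
                  let n := \sum_alpha w alpha * nu alpha i in
                  (m = 0 /\ 0 <= n) \/ C i (- m, n)].
Proof.
move=> hC mu0 muF nuT.
(* A bound for the l^1 norm of every (-m_i, r_i), since |r_i| <= m_i + |n_i|; the summand 1 makes it
   positive. *)
pose M := 1 + \sum_alpha \sum_i (2 * mu alpha i + `|nu alpha i|).
have M0 : 0 < M.
  rewrite ltr_wpDr // sumr_ge0 // => b _; rewrite sumr_ge0 // => i _.
  by rewrite addr_ge0 // mulr_ge0.
pose pt := 'rV[(R * R)%type]_(p + p).
pose t (x : pt) i := (x 0 (lshift p i)).1.
pose c (x : pt) i := x 0 (rshift p i).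
pose m (x : pt) i := \sum_alpha corner_weight (t x) alpha * mu alpha i.
pose n (x : pt) i := \sum_alpha corner_weight (t x) alpha * nu alpha i.
pose r (x : pt) i := Num.min (n x i) (m x i).
pose F1 i (x : pt) := - (m x i * (c x i).2) - r x i * (c x i).1.
pose F2 i (x : pt) := - (c x i).1 - (c x i).2 - (m x i + `|r x i|).
pose X (u : 'I_p + 'I_p) : set (R * R) := match u with
  | inl i => `[0 : R, 1] `*` [set (0 : R)]
  | inr i => C i `&` [set z | - z.1 - z.2 <= M + 2] end.
pose A (u : 'I_p + 'I_p) : set (R * R) := match u with
  | inl i => [set (0, 0)] | inr i => [set (0, 0)] end.
pose B (u : 'I_p + 'I_p) : set (R * R) := match u with
  | inl i => [set (1, 0)] | inr i => [set z | M <= - z.1 - z.2] end.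
pose F u := match u with inl i => F1 i | inr i => F2 i end.
have cpt j : continuous (fun x : pt => x 0 j) by exact: entry_continuous.
have cfst j : continuous (fun x : pt => (x 0 j).1).
  move=> x; apply: (@cvg_comp _ _ _ (fun x : pt => x 0 j) fst); first exact: cpt.
  exact: cvg_fst.
have csnd j : continuous (fun x : pt => (x 0 j).2).
  move=> x; apply: (@cvg_comp _ _ _ (fun x : pt => x 0 j) snd); first exact: cpt.
  exact: cvg_snd.
have cw alpha : continuous (fun x => corner_weight (t x) alpha).
  by apply: continuous_corner_weight => i; exact: cfst.
have cm i : continuous (m^~ i).
  by apply: continuous_sum_fun => b; apply: continuousM_fun => //; exact: cst_continuous.
have cn i : continuous (n^~ i).
  by apply: continuous_sum_fun => b; apply: continuousM_fun => //; exact: cst_continuous.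
have cr i : continuous (r^~ i) by exact: continuous_min_fun.
have cF u : continuous (F u).
  case: u => i.
    apply: continuousD_fun; apply: continuousN_fun; apply: continuousM_fun => //.
      exact: csnd.
    exact: cfst.
  apply: continuousD_fun.
    apply: continuousD_fun; apply: continuousN_fun; [exact: cfst | exact: csnd].
  by apply: continuousN_fun; apply: continuousD_fun => //; exact: continuous_norm_fun.
have cptX u : compact (X u).
  case: u => i /=.
    by apply: compact_setX; [exact: segment_compact | exact: compact_set1].
  have [Cq clC _ _ _] := hC i.
  apply: (@subclosed_compact _ _ (`[- (M + 2), 0] `*` `[- (M + 2), 0])).
  - apply: closedI => //.
    have -> : [set z : R * R | - z.1 - z.2 <= M + 2] =
        (fun z => - z.1 - z.2) @^-1` [set y | y <= M + 2] by [].
    apply: preimage_closed; last exact: closed_le.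
    move=> z _; apply: continuousD_fun; apply: continuousN_fun => y.
      exact: cvg_fst.
    exact: cvg_snd.
  - by apply: compact_setX; exact: segment_compact.
  - move=> z [/Cq /=]; rewrite !in_itv /= => -[z1 z2] zM; split; apply/andP; split; lra.
have chX u (e : R) : 0 < e ->
    exists N c a b, [/\ A u a, B u b & chain (X u) e a b N c].
  move=> e0; case: u => i /=.
    have [N [d Nd]] := unit_interval_chain e0.
    by exists N, d, (0, 0), (1, 0).
  have [Cq _ conC unb C0] := hC i.
  have [N [d [b [bM ch]]]] := third_quadrant_chain Cq conC unb C0 M0 e0.
  by exists N, d, (0, 0), b.
pose K (x : pt) := forall j : 'I_(p + p), X (fintype.split j) (x 0 j).
have tX (x : pt) : K x -> forall i, 0 <= t x i <= 1.
  move=> Xx i; have := Xx (lshift p i); rewrite (unsplitK (inl i)) /= in_itv /= => -[].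
  by [].
have cX (x : pt) : K x -> forall i, C i (c x i).
  by move=> Xx i; have := Xx (rshift p i); rewrite (unsplitK (inr i)) => -[].
have cX0 (x : pt) : K x -> forall i, (c x i).1 <= 0 /\ (c x i).2 <= 0.
  move=> Xx i; have [Cq _ _ _ _] := hC i; have := Cq _ (cX _ Xx i).
  by rewrite /= !in_itv.
have mX (x : pt) : K x -> forall i, 0 <= m x i.
  move=> Xx i; apply: sumr_ge0 => b _; rewrite mulr_ge0 // corner_weight_ge0 //.
  exact: tX.
have FA u (x : pt) : K x -> A u (x 0 (unsplit u)) -> F u x <= 0.
  move=> Xx; have mx := mX _ Xx; have cx := cX0 _ Xx.
  case: u => i /=; last first.
    by rewrite /F2 /c => -> /=; have := mx i; have := normr_ge0 (r x i); lra.
  (* At t_i = 0 only corners with [alpha i] false have weight, so m_i = 0 and r_i <= 0. *)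
  move=> ti; have {}ti : t x i = false%:R by rewrite /t ti.
  have -> : F1 i x = - (r x i * (c x i).1).
    rewrite /F1 (_ : m x i = 0) ?mul0r ?oppr0 ?add0r //.
    rewrite /m big1 // => b _; case bi: (b i); last by rewrite muF ?mulr0.
    by rewrite (corner_weight_face ti) ?bi ?mul0r.
  have r0 : r x i <= 0.
    rewrite /r ge_min (_ : m x i = 0) ?lexx ?orbT //.
    rewrite /m big1 // => b _; case bi: (b i); last by rewrite muF ?mulr0.
    by rewrite (corner_weight_face ti) ?bi ?mul0r.
  by rewrite oppr_le0 mulr_le0 //; case: (cx i).
have FB u (x : pt) : K x -> B u (x 0 (unsplit u)) -> 0 <= F u x.
  move=> Xx; have mx := mX _ Xx; have cx := cX0 _ Xx; have tx := tX _ Xx.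
  case: u => i /=; last first.
    rewrite /F2 => Mc.
    suff : m x i + `|r x i| <= M by rewrite /c; lra.
    apply: (@le_trans _ _ (2 * m x i + `|n x i|)).
      by have := min_norm_le (n x i) (mx i); rewrite -/(r x i); lra.
    apply: (@le_trans _ _ (\sum_alpha (2 * mu alpha i + `|nu alpha i|))).
      rewrite /m /n mulr_sumr big_split /= lerD //; last first.
        apply: le_trans (ler_norm_sum _ _ _) _; apply: ler_sum => b _.
        rewrite normrM ger0_norm ?corner_weight_ge0 //.
        by rewrite ler_piMl // corner_weight_le1.
      apply: ler_sum => b _; rewrite ler_pM2l //.
      by rewrite ler_piMl // corner_weight_le1.
    rewrite /M ler_wpDl //; apply: ler_sum => b _; rewrite (bigD1 i) //= lerDl.
    by rewrite sumr_ge0 // => j _; rewrite addr_ge0 // mulr_ge0.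
  (* At t_i = 1 only corners with [alpha i] true have weight, so n_i and r_i are nonnegative. *)
  move=> ti; have {}ti : t x i = true%:R by rewrite /t ti.
  have n0 : 0 <= n x i.
    rewrite /n sumr_ge0 // => b _; case bi: (b i).
      by rewrite mulr_ge0 ?corner_weight_ge0 // nuT.
    by rewrite (corner_weight_face ti) ?bi ?mul0r.
  have r0 : 0 <= r x i by rewrite /r le_min n0 mx.
  have [c1 c2] := cx i.
  by rewrite /F1 addr_ge0 // -mulrN mulr_ge0 // oppr_ge0.
pose sp := @fintype.split p p.
have [|||||x [Xx Fx]] := @chain_poincare_miranda R (R * R)%type (p + p)
    (X \o sp) (A \o sp) (B \o sp) (F \o sp).
- by move=> j; exact: cptX.
- by move=> j e e0; exact: chX.
- by move=> j; exact: cF.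
- by move=> j x Xx; have := FA (fintype.split j) x Xx; rewrite splitK.
- by move=> j x Xx; have := FB (fintype.split j) x Xx; rewrite splitK.
exists (corner_weight (t x)); split.
- by move=> b; apply: corner_weight_ge0; exact: tX.
- exact: corner_weight_sum.
move=> i; rewrite /= -/(m x i) -/(n x i).
have F1x := Fx (lshift p i); have F2x := Fx (rshift p i).
rewrite /= /sp (unsplitK (inl i)) /F /F1 in F1x.
rewrite /= /sp (unsplitK (inr i)) /F /F2 in F2x.
have [c1 c2] := cX0 _ Xx i; have mx := mX _ Xx i.
have rm : r x i <= m x i by rewrite /r ge_min lexx orbT.
have [|mE rE] := parallel_eq c1 c2 mx rm F1x; first lra.
have [nm|mn] := lerP (n x i) (m x i).
  right; have := cX _ Xx i; rewrite [c x i]surjective_pairing -rE mE opprK.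
  by rewrite /r (min_idPl nm).
(* Here r_i = m_i is nonnegative and equals the nonpositive ordinate of c_i, hence it is 0. *)
left; move: rE; rewrite /r (min_idPr (ltW mn)) => mc; split; lra.
Qed.

(** * Convex combinations of multipliers and the stationarity conditions *)

Lemma scale_row_sum (R : realType) (I : finType) (n k : nat) (w : I -> R)
    (M : I -> 'rV[R]_k) (v : 'I_k -> 'rV[R]_n) :
  \sum_(i < k) (\sum_a w a *: M a) 0 i *: v i =
  \sum_a w a *: \sum_(i < k) M a 0 i *: v i.
Proof.
under eq_bigr do rewrite summxE scaler_suml.
rewrite exchange_big; apply: eq_bigr => a _ /=.
by rewrite scaler_sumr; apply: eq_bigr => i _; rewrite mxE scalerA.
Qed.

Lemma weak_stationarity_convex (R : realType) (n l m p : nat) (P : mpvc R n l m p)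
    (x : 'rV[R]_n) (I : finType) (w : I -> R) (lambda : I -> 'rV[R]_l)
    (eta : I -> 'rV[R]_m) (mu nu : I -> 'rV[R]_p) :
  (forall a, 0 <= w a) -> \sum_a w a = 1 ->
  (forall a, weak_stationarity_system P x (lambda a) (eta a) (mu a) (nu a)) ->
  weak_stationarity_system P x (\sum_a w a *: lambda a) (\sum_a w a *: eta a)
    (\sum_a w a *: mu a) (\sum_a w a *: nu a).
Proof.
move=> w0 w1 S.
have entry k (M : I -> 'rV[R]_k) i : (\sum_a w a *: M a) 0 i = \sum_a w a * M a 0 i.
  by rewrite summxE; apply: eq_bigr => a _; rewrite mxE.
have entry0 k (M : I -> 'rV[R]_k) i :
    (forall a, M a 0 i = 0) -> (\sum_a w a *: M a) 0 i = 0.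
  by move=> M0; rewrite entry big1 // => a _; rewrite M0 mulr0.
have entry_ge0 k (M : I -> 'rV[R]_k) i :
    (forall a, 0 <= M a 0 i) -> 0 <= (\sum_a w a *: M a) 0 i.
  by move=> M0; rewrite entry sumr_ge0 // => a _; rewrite mulr_ge0.
split.
- rewrite !scale_row_sum -[grad (fobj P) x]scale1r -w1 scaler_suml.
  rewrite -!big_split -sumrB big1 //= => a _.
  by have [e _ _ _] := S a; rewrite -!scalerDr -scalerBr e scaler0.
- split=> i iI; [apply: entry_ge0 => a | apply: entry0 => a].
    by have [_ [+ _] _ _] := S a; apply.
  by have [_ [_ +] _ _] := S a; apply.
- split=> i iI; [apply: entry0 => a | apply: entry_ge0 => a].
    by have [_ _ [+ _] _] := S a; apply.
  by have [_ _ [_ +] _] := S a; apply.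
- split=> i iI; [apply: entry0 => a | apply: entry_ge0 => a].
    by have [_ _ _ [+ _]] := S a; apply.
  by have [_ _ _ [_ +]] := S a; apply.
Qed.

Lemma Aalpha_stationary_crossing (R : realType) (n l m p : nat) (P : mpvc R n l m p)
    (x : 'rV[R]_n) (C : 'I_p -> set (R * R)) :
  (forall alpha, Aalpha_stationary P alpha x) ->
  (forall i, [/\ C i `<=` `]-oo, 0] `*` `]-oo, 0], closed (C i), connected (C i),
                 ~ bounded_set (C i) & C i (0, 0)]) ->
  exists (lambda : 'rV[R]_l) (eta : 'rV[R]_m) (mu nu : 'rV[R]_p),
    weak_stationarity_system P x lambda eta mu nu /\
    forall i, i \in I00 P x ->
      (mu 0 i = 0 /\ 0 <= nu 0 i) \/ C i (- mu 0 i, nu 0 i).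
Proof.
move=> SA hC.
have [|u uP] := @boolp.choice _ _ (fun (alpha : {ffun 'I_p -> bool})
    (u : ('rV[R]_l * 'rV[R]_m) * ('rV[R]_p * 'rV[R]_p)) =>
  [/\ weak_stationarity_system P x u.1.1 u.1.2 u.2.1 u.2.2,
      forall i, i \in I00_alpha P alpha false x -> u.2.1 0 i = 0 &
      forall i, i \in I00_alpha P alpha true x -> 0 <= u.2.2 0 i]).
  by move=> alpha; have [_ [la [et [mu [nu H]]]]] := SA alpha; exists ((la, et), (mu, nu)).
(* Off [I00] the multipliers may violate the sign conditions that [corner_crossing] demands for
   every [i]; 0 satisfies them, and the conclusion is read on [I00] only. *)
pose mu alpha i := if i \in I00 P x then (u alpha).2.1 0 i else 0.
pose nu alpha i := if i \in I00 P x then (u alpha).2.2 0 i else 0.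
have [|||w [w0 w1 wC]] := @corner_crossing R p C mu nu hC.
- move=> alpha i; rewrite /mu; case: ifP => // iI.
  by have [[_ _ [_ +] _] _ _] := uP alpha; apply; rewrite inE iI orbT.
- move=> alpha i ai; rewrite /mu; case: ifP => // iI.
  by have [_ + _] := uP alpha; apply; rewrite inE iI ai.
- move=> alpha i ai; rewrite /nu; case: ifP => // iI.
  by have [_ _] := uP alpha; apply; rewrite inE iI ai.
exists (\sum_a w a *: (u a).1.1), (\sum_a w a *: (u a).1.2),
  (\sum_a w a *: (u a).2.1), (\sum_a w a *: (u a).2.2); split.
  by apply: weak_stationarity_convex => // a; have [] := uP a.
have entry (M : {ffun 'I_p -> bool} -> 'rV[R]_p) i :
    (\sum_a w a *: M a) 0 i = \sum_a w a * M a 0 i.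
  by rewrite summxE; apply: eq_bigr => a _; rewrite mxE.
by move=> i iI; have := wC i; rewrite /= /mu /nu iI !entry.
Qed.

(** At z = (-mu, nu) the equation is that of P_d-stationarity. The set is the ray spanned by (-d,
    -(1 - d)), parametrized in [CE] by the l^1 norm. *)
Lemma third_quadrant_ray (R : realType) (d : R) : 0 <= d <= 1 ->
  let C := [set z : R * R | [/\ z.1 <= 0, z.2 <= 0 & (1 - d) * z.1 - d * z.2 = 0]] in
  [/\ C `<=` `]-oo, 0] `*` `]-oo, 0], closed C, connected C,
      ~ bounded_set C & C (0, 0)].
Proof.
move=> /andP[d0 d1] C.
have CE : C = (fun s : R => (- (s * d), - (s * (1 - d)))) @` `[0, +oo[.
  apply/seteqP; split=> [[a b] [/= a0 b0 ab]|_ [s + <-]].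
    exists (- a - b); first by rewrite /= in_itv /= andbT; lra.
    by congr pair; lra.
  rewrite /= in_itv /= andbT => s0; rewrite /C /=; split; last by ring.
    by rewrite oppr_le0 mulr_ge0.
  by rewrite oppr_le0 mulr_ge0 // subr_ge0.
have cfst : continuous (fun z : R * R => z.1) by move=> z; exact: cvg_fst.
have csnd : continuous (fun z : R * R => z.2) by move=> z; exact: cvg_snd.
split.
- by move=> z [z1 z2 _]; rewrite /= !in_itv.
- have -> : C = [set z | z.1 <= 0] `&` [set z | z.2 <= 0] `&`
      [set z | (1 - d) * z.1 - d * z.2 = 0].
    by apply/seteqP; split=> z => [[]|[[]]].
  apply: closedI; first apply: closedI.
  + by apply: (@preimage_closed _ _ (fun z : R * R => z.1) [set y | y <= 0]);
      [move=> z _; exact: cfst | exact: closed_le].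
  + by apply: (@preimage_closed _ _ (fun z : R * R => z.2) [set y | y <= 0]);
      [move=> z _; exact: csnd | exact: closed_le].
  + apply: (@preimage_closed _ _ (fun z : R * R => (1 - d) * z.1 - d * z.2)
        [set y | y = 0]); last exact: closed_eq.
    move=> z _; apply: continuousD_fun; last apply: continuousN_fun.
      by apply: continuousM_fun => //; exact: cst_continuous.
    by apply: continuousM_fun => //; exact: cst_continuous.
- rewrite CE; apply: connected_continuous_connected.
    by apply/connected_intervalP; exact: interval_is_interval.
  have cM (a : R) : continuous (fun s : R => - (s * a)).
    by move=> s; apply: cvgN; exact: mulrr_continuous.
  apply: continuous_subspaceT => s; exact: (cvg_pair (cM d s) (cM (1 - d) s)).
- move=> [M [_ /(_ (`|M| + 1))]]; have M1 : M < `|M| + 1 by have := ler_norm M; lra.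
  (* The absolute values of the coordinates at this parameter add up to 2|M| + 4, so they are not
     both at most |M| + 1. *)
  move=> /(_ M1) H; have s0 : 0 <= 2 * (`|M| + 2) by have := normr_ge0 M; lra.
  have /H : C (- (2 * (`|M| + 2) * d), - (2 * (`|M| + 2) * (1 - d))).
    by rewrite CE; exists (2 * (`|M| + 2)) => //=; rewrite in_itv /= s0.
  rewrite /= prod_normE /= ge_max !normrN.
  have dC0 : 0 <= 1 - d by lra.
  rewrite !(ger0_norm (mulr_ge0 s0 _)) //.
  by move=> /andP[]; have := normr_ge0 M; lra.
- by rewrite /C /=; split=> //; rewrite !mulr0 subrr.
Qed.

Lemma Aalpha_Pd_stationary (R : realType) (n l m p : nat) (P : mpvc R n l m p)
    (x : 'rV[R]_n) (d : 'rV[R]_p) :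
  feasible P x -> (forall alpha, Aalpha_stationary P alpha x) ->
  (forall i, 0 <= d 0 i <= 1) -> Pd_stationary P d x.
Proof.
move=> xF SA d01; split=> //.
have [la [et [mu [nu [S H]]]]] :=
  Aalpha_stationary_crossing SA (fun i => third_quadrant_ray (d01 i)).
exists la, et, mu, nu; split=> // i /H[]; [by left | case=> /= _ _ e; right; lra].
Qed.

(** The equation of P_d-stationarity reads mu_i = 0 for d_i = 0 and nu_i = 0 for d_i = 1. *)
Lemma Aalpha_Palpha_stationary (R : realType) (n l m p : nat) (P : mpvc R n l m p)
    (x : 'rV[R]_n) (alpha : {ffun 'I_p -> bool}) :
  feasible P x -> (forall beta, Aalpha_stationary P beta x) ->
  Palpha_stationary P alpha x.
Proof.
move=> xF SA; split=> //.
have [|_ [la [et [mu [nu [S H]]]]]] :=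
    Aalpha_Pd_stationary (d := \row_i (alpha i)%:R) xF SA.
  by move=> i; rewrite mxE; case: (alpha i); rewrite /= ?lexx ler01.
exists la, et, mu, nu; split=> // i; rewrite inE => /andP[/H + /eqP ai]; rewrite mxE ai.
  by case=> [[]//|] /=; lra.
by case=> [|/= e]; [left | right; lra].
Qed.

(** * The inner product and Farkas' lemma *)

Section DotProduct.
Variables (R : realType) (n : nat).
Implicit Types (u v w : 'rV[R]_n) (a : R).

Lemma dotC u v : dot u v = dot v u.
Proof. by apply: eq_bigr => j _; rewrite mulrC. Qed.

Lemma dotDl u v w : dot (u + v) w = dot u w + dot v w.
Proof. by rewrite -big_split; apply: eq_bigr => j _; rewrite mxE mulrDl. Qed.

Lemma dotZl a u v : dot (a *: u) v = a * dot u v.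
Proof. by rewrite /dot mulr_sumr; apply: eq_bigr => j _; rewrite mxE mulrA. Qed.

Lemma dotNl u v : dot (- u) v = - dot u v.
Proof. by rewrite -scaleN1r dotZl mulN1r. Qed.

Lemma dotBl u v w : dot (u - v) w = dot u w - dot v w.
Proof. by rewrite dotDl dotNl. Qed.

Lemma dotBr u v w : dot u (v - w) = dot u v - dot u w.
Proof. by rewrite dotC dotBl !(dotC u). Qed.

Lemma dotZr a u v : dot u (a *: v) = a * dot u v.
Proof. by rewrite dotC dotZl dotC. Qed.

Lemma dot_eq0 u : dot u u <= 0 -> u = 0.
Proof.
move=> u0; apply/rowP => j; rewrite mxE; apply/eqP; rewrite -sqrf_eq0 expr2.
rewrite eq_le -expr2 sqr_ge0 andbT expr2.
apply: le_trans u0; rewrite /dot (bigD1 j) //= lerDl sumr_ge0 // => k _.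
by rewrite -expr2 sqr_ge0.
Qed.

(* Bartl's induction: if the inequality of i is needed, project onto the
   hyperplane of A i along a vector z which violates only this inequality. *)
Lemma farkas_seq (I : eqType) (s : seq I) (A : I -> 'rV[R]_n) (c : 'rV[R]_n) :
  uniq s ->
  (forall d, (forall i, i \in s -> dot (A i) d <= 0) -> dot c d <= 0) ->
  exists y : I -> R, (forall i, 0 <= y i) /\ c = \sum_(i <- s) y i *: A i.
Proof.
elim: s A c => [|i s IHs] A c /=.
  by move=> _ H; exists (fun=> 0); split=> //; rewrite big_nil; apply/dot_eq0/H.
move=> /andP[iNs us] H.
have set0 (y : I -> R) b :
    \sum_(j <- s) (if j == i then b else y j) *: A j = \sum_(j <- s) y j *: A j.
  apply: eq_big_seq => j js; case: eqP => // ji.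
  by rewrite ji (negbTE iNs) in js.
have [Hs|/existsNP[z /not_implyP[zs /negP]]] :=
    pselect (forall d, (forall j, j \in s -> dot (A j) d <= 0) -> dot c d <= 0).
  have [y [y0 yE]] := IHs _ _ us Hs.
  exists (fun j => if j == i then 0 else y j); split; first by move=> j; case: ifP.
  by rewrite big_cons eqxx scale0r add0r set0.
rewrite -ltNge => cz.
have Aiz : 0 < dot (A i) z.
  rewrite ltNge; apply/negP => Aiz; move: cz; rewrite ltNge => /negP; apply.
  by apply: H => j; rewrite inE => /predU1P[->|/zs].
(* The adjoint of the projection along [z] onto the hyperplane orthogonal to [A i]; it kills
   [A i]. *)
pose proj (u : 'rV[R]_n) : 'rV[R]_n := u - (dot u z / dot (A i) z) *: A i.
have dot_proj u d : dot (proj u) d = dot u (d - (dot (A i) d / dot (A i) z) *: z).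
  by rewrite dotBr dotZr /proj dotBl dotZl mulrAC [in RHS]mulrAC [dot u z * _]mulrC.
have [|y [y0 yE]] := IHs (proj \o A) (proj c) us.
  move=> d Hd; rewrite dot_proj; apply: H => j; rewrite inE => /predU1P[->|js].
    rewrite dotBr dotZr divfK ?subrr //.
    by rewrite gt_eqF.
  by rewrite -dot_proj; exact: Hd.
(* Found by testing the desired identity against [z]; it is nonnegative because [z] violates only
   the inequality of [i]. *)
pose b := (dot c z - \sum_(j <- s) y j * dot (A j) z) / dot (A i) z.
exists (fun j => if j == i then b else y j); split.
  move=> j; case: ifP => // _; apply: divr_ge0; last exact: ltW.
  rewrite subr_ge0.
  apply: le_trans (ltW cz); rewrite big_seq; apply: sumr_le0 => k ks.
  by rewrite mulr_ge0_le0 // zs.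
rewrite big_cons eqxx set0 /b.
have -> : c = proj c + (dot c z / dot (A i) z) *: A i by rewrite subrK.
rewrite {1}yE /= /proj.
under eq_bigr do rewrite scalerBr scalerA mulrA.
rewrite sumrB -addrA addrC; congr (_ + _).
rewrite -scaler_suml -mulr_suml -scaleNr -scalerDl; congr (_ *: _).
by rewrite subrK mulrBl addrC.
Qed.

Lemma farkas (I : finType) (A : I -> 'rV[R]_n) (c : 'rV[R]_n) :
  (forall d, (forall i, dot (A i) d <= 0) -> dot c d <= 0) ->
  exists y : I -> R, (forall i, 0 <= y i) /\ c = \sum_i y i *: A i.
Proof.
move=> H; apply: farkas_seq; first exact: index_enum_uniq.
by move=> d Hd; apply: H => i; apply: Hd; rewrite mem_index_enum.
Qed.

(** * First-order conditions at a local minimizer *)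

Lemma diff_grad (f : 'rV[R]_n -> R) (x d : 'rV[R]_n) :
  differentiable f x -> 'd f x d = dot (grad f x) d.
Proof.
move=> df; rewrite [in LHS](row_sum_delta d) linear_sum /=.
apply: eq_bigr => j _; rewrite linearZ /= mxE deriveE // mulrC.
by [].
Qed.

(** Minimality and differentiability give ['d f x (q k) + e * |q k| >= 0] for the difference
    quotients [q k] and large [k]; then k tends to infinity, and [e] is arbitrary. *)
Lemma tangent_descent (f : 'rV[R]_n -> R) (F : set 'rV[R]_n) (x : 'rV[R]_n) :
  differentiable f x -> (\forall y \near x, F y -> f x <= f y) ->
  polar_cone (tangent_cone F x) (- grad f x).
Proof.
move=> df fmin d [x_ [t_ [Fx t0 xx tt qd]]].
rewrite dotNl oppr_le0 -diff_grad //.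
have cdf : continuous ('d f x) by exact: diff_continuous.
suff H e : 0 < e -> 0 <= 'd f x d + e * `|d|.
  rewrite leNgt; apply/negP => d0.
  (* With this [e] the error is at most half of the supposed descent. *)
  pose e := - 'd f x d / (2 * (`|d| + 1)).
  have d1 : 0 < `|d| + 1 by rewrite ltr_wpDl.
  have e0 : 0 < e by rewrite divr_gt0 ?mulr_gt0 // oppr_gt0.
  have := H _ e0; rewrite leNgt => /negP; apply.
  have : e * (`|d| + 1) = - 'd f x d / 2 by rewrite /e; field; lra.
  have : 0 < e * 1 by lra.
  lra.
move=> e0.
pose q k := (t_ k)^-1 *: (x_ k - x).
have near_q : \forall k \near \oo, 0 <= 'd f x (q k) + e * `|q k|.
  have fmin' : \forall k \near \oo, F (x_ k) -> f x <= f (x_ k) by exact: xx fmin.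
  have /eqaddoP/(_ e e0) fo := diff_locally df.
  have x0 : x_ k - x @[k --> \oo] --> (0 : 'rV[R]_n).
    by rewrite -(subrr x); apply: cvgB => //; exact: cvg_cst.
  have fo' : \forall k \near \oo,
      `|f (x_ k) - (f x + 'd f x (x_ k - x))| <= e * `|x_ k - x|.
    by near do rewrite -[X in f X - _](subrK x); exact: (x0 _ fo).
  near=> k.
  have fk : f x <= f (x_ k) by near: k; exact: filterS (fun k H => H (Fx k)) fmin'.
  have : `|f (x_ k) - (f x + 'd f x (x_ k - x))| <= e * `|x_ k - x| by near: k.
  have tk : 0 < (t_ k)^-1 by rewrite invr_gt0.
  move=> /(le_trans (ler_norm _)) H.
  have : 0 <= (t_ k)^-1 * ('d f x (x_ k - x) + e * `|x_ k - x|).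
    by apply: mulr_ge0; [exact: ltW | lra].
  by rewrite /q linearZ /= normrZ (gtr0_norm tk) mulrDr mulrCA.
have lim : ('d f x (q k) + e * `|q k|) @[k --> \oo] --> 'd f x d + e * `|d|.
  apply: cvgD; first by apply: (@cvg_comp _ _ _ q ('d f x)); [exact: qd | exact: cdf].
  by apply: cvgMr; apply: cvg_norm.
rewrite -(cvg_lim _ lim) //; apply: limr_ge near_q; apply/cvg_ex.
by exists ('d f x d + e * `|d|).
Unshelve. all: by end_near. Qed.

End DotProduct.

(** The polyhedral cone selects a branch of each product condition on [I00]: where [alpha] is true,
    G_i may not increase nor H_i decrease to first order; where it is false, H_i is stationary.
    Hence nu_i >= 0 in the first case and mu_i = 0 in the second. *)
Lemma GCQ_Aalpha_stationary (R : realType) (n l m p : nat) (P : mpvc R n l m p)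
    (x : 'rV[R]_n) (alpha : {ffun 'I_p -> bool}) :
  differentiable (fobj P) x -> local_minimizer P x -> mpvc_GCQ P x ->
  Aalpha_stationary P alpha x.
Proof.
move=> df [xF fmin] [_ gcq]; split=> //.
have : polar_cone (mpvc_linearized_cone P x) (- grad (fobj P) x).
  by rewrite -gcq; exact: tangent_descent.
move=> polar_f.
pose actG i := (i \in I0p P x) || (i \in I00_alpha P alpha true x).
pose actH i := [|| i \in Ip0 P x, i \in I00 P x | i \in In0 P x].
pose eqH i := (i \in Ip0 P x) || (i \in I00_alpha P alpha false x).
have in00 b i : i \in I00 P x -> alpha i = b -> i \in I00_alpha P alpha b x.
  by move=> iI ai; apply/setIdP; rewrite ai eqxx.
pose Dg i := grad (comp_fun (gcon P) i) x.
pose Dh i := grad (comp_fun (hcon P) i) x.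
pose DG i := grad (comp_fun (Gcon P) i) x.
pose DH i := grad (comp_fun (Hcon P) i) x.
(* Equations become pairs of opposite inequalities, and inactive constraints the zero vector. *)
pose A (u : ('I_l + ('I_m + 'I_m)) + ('I_p + ('I_p + 'I_p))) : 'rV[R]_n :=
  match u with
  | inl (inl i) => if i \in Ig P x then Dg i else 0
  | inl (inr (inl i)) => Dh i
  | inl (inr (inr i)) => - Dh i
  | inr (inl i) => if actG i then DG i else 0
  | inr (inr (inl i)) => if actH i then - DH i else 0
  | inr (inr (inr i)) => if eqH i then DH i else 0
  end.
have [d Ad|y [y0 yE]] := @farkas R n _ A (- grad (fobj P) x).
  have dg i : i \in Ig P x -> dot (Dg i) d <= 0.
    by move=> iI; have := Ad (inl (inl i)); rewrite /= iI.
  have dh i : dot (Dh i) d = 0.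
    apply/eqP; rewrite eq_le (Ad (inl (inr (inl i)))) /=.
    by have := Ad (inl (inr (inr i))); rewrite /= dotNl oppr_le0.
  have dG i : actG i -> dot (DG i) d <= 0.
    by move=> iI; have := Ad (inr (inl i)); rewrite /= iI.
  have dH i : actH i -> 0 <= dot (DH i) d.
    by move=> iI; have := Ad (inr (inr (inl i))); rewrite /= iI dotNl oppr_le0.
  have dH0 i : actH i -> eqH i -> dot (DH i) d = 0.
    move=> /dH dH0 iI; apply/eqP; rewrite eq_le dH0 andbT.
    by have := Ad (inr (inr (inr i))); rewrite /= iI.
  apply: polar_f; split=> [|i iI|i iI|i|i iI].
  - by split.
  - by apply: dG; rewrite /actG iI.
  - by apply: dH0; rewrite /actH /eqH iI.
  - by rewrite inE => /orP[] iI; apply: dH; rewrite /actH iI ?orbT.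
  - have iH : actH i by rewrite /actH iI orbT.
    case ai: (alpha i); last first.
      by rewrite [X in _ * X](dH0 i iH) ?mulr0 // /eqH in00 ?orbT.
    by rewrite mulr_le0_ge0 //; [apply: dG; rewrite /actG in00 ?orbT | exact: dH].
pose la := \row_i if i \in Ig P x then y (inl (inl i)) else 0.
pose et := \row_i (y (inl (inr (inl i))) - y (inl (inr (inr i)))).
pose mu := \row_i if actG i then y (inr (inl i)) else 0.
pose nu := \row_i ((if actH i then y (inr (inr (inl i))) else 0) -
                   (if eqH i then y (inr (inr (inr i))) else 0)).
exists la, et, mu, nu.
(* The signs of G_i and H_i decide all memberships in the index sets below. *)
have cmpG i := ltgtP (Gcon P x 0 i) 0; have cmpH i := ltgtP (Hcon P x 0 i) 0.
split; first split.
- rewrite -[grad (fobj P) x]opprK yE !big_sumType /=.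
  have e1 : \sum_(i < l) la 0 i *: Dg i =
      \sum_(i < l) y (inl (inl i)) *: (if i \in Ig P x then Dg i else 0).
    by apply: eq_bigr => i _; rewrite mxE; case: ifP; rewrite ?scale0r ?scaler0.
  have e2 : \sum_(i < m) et 0 i *: Dh i =
      \sum_(i < m) y (inl (inr (inl i))) *: Dh i +
      \sum_(i < m) y (inl (inr (inr i))) *: - Dh i.
    by rewrite -big_split; apply: eq_bigr => i _; rewrite mxE scalerBl scalerN.
  have e3 : \sum_(i < p) mu 0 i *: DG i =
      \sum_(i < p) y (inr (inl i)) *: (if actG i then DG i else 0).
    by apply: eq_bigr => i _; rewrite mxE; case: ifP; rewrite ?scale0r ?scaler0.
  have e4 : - \sum_(i < p) nu 0 i *: DH i =
      \sum_(i < p) y (inr (inr (inl i))) *: (if actH i then - DH i else 0) +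
      \sum_(i < p) y (inr (inr (inr i))) *: (if eqH i then DH i else 0).
    rewrite -big_split -sumrN; apply: eq_bigr => i _.
    rewrite mxE scalerBl opprB addrC /=.
    by congr (_ + _); case: ifP; rewrite ?scale0r ?scaler0 ?oppr0 ?scalerN.
  rewrite e1 e2 e3 e4.
  by rewrite -!addrA addrC !addrA subrr.
- split=> i iI; rewrite mxE; first by case: ifP.
  by rewrite (negbTE iI).
- split=> i; rewrite mxE; last by case: ifP.
  rewrite !inE => iI; rewrite ifN // /actG !inE.
  by move: iI; rewrite /comp_fun; case: (cmpG i); case: (cmpH i).
- split=> i iI; rewrite mxE.
    have nH : actH i = false.
      by move: iI; rewrite /actH !inE /comp_fun; case: (cmpG i); case: (cmpH i).
    have nE : eqH i = false.
      by move: iI; rewrite /eqH !inE /comp_fun; case: (cmpG i); case: (cmpH i).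
    by rewrite nH nE subrr.
  have -> : eqH i = false.
    by move: iI; rewrite /eqH !inE /comp_fun; case: (cmpG i); case: (cmpH i).
  by rewrite subr0; case: ifP.
- move=> i iI; rewrite mxE ifN //; move: iI; rewrite /actG !inE /comp_fun.
  by case: (alpha i); case: (cmpG i); case: (cmpH i).
- move=> i iI; rewrite mxE.
  have -> : eqH i = false.
    move: iI; rewrite /eqH !inE /comp_fun.
    by case: (alpha i); case: (cmpG i); case: (cmpH i).
  by rewrite subr0; case: ifP.
Qed.

(** * Conditions (a), (b), (c) under A_alpha-stationarity and at local minimizers *)

Theorem theorem6p2 (R : realType) (n l m p : nat) (P : mpvc R n l m p)
    (hdiff : mpvc_differentiable P) (x : 'rV[R]_n) (hx : feasible P x) :
  ((forall alpha : {ffun 'I_p -> bool}, Aalpha_stationary P alpha x) ->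
   [/\ forall C : 'I_p -> set (R * R),
         (forall i, [/\ C i `<=` `]-oo, 0%R] `*` `]-oo, 0%R],
                        closed (C i), connected (C i),
                        ~ bounded_set (C i) & C i (0, 0)]) ->
         exists (lambda : 'rV[R]_l) (eta : 'rV[R]_m) (mu nu : 'rV[R]_p),
           weak_stationarity_system P x lambda eta mu nu /\
           forall i, i \in I00 P x ->
             (mu 0 i = 0 /\ 0 <= nu 0 i) \/ C i (- mu 0 i, nu 0 i),
       forall d : 'rV[R]_p,
         (forall i, 0 <= d 0 i <= 1) -> Pd_stationary P d x &
       forall alpha : {ffun 'I_p -> bool}, Palpha_stationary P alpha x])
  /\
  (local_minimizer P x -> mpvc_GCQ P x ->
   [/\ forall C : 'I_p -> set (R * R),
         (forall i, [/\ C i `<=` `]-oo, 0%R] `*` `]-oo, 0%R],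
                        closed (C i), connected (C i),
                        ~ bounded_set (C i) & C i (0, 0)]) ->
         exists (lambda : 'rV[R]_l) (eta : 'rV[R]_m) (mu nu : 'rV[R]_p),
           weak_stationarity_system P x lambda eta mu nu /\
           forall i, i \in I00 P x ->
             (mu 0 i = 0 /\ 0 <= nu 0 i) \/ C i (- mu 0 i, nu 0 i),
       forall d : 'rV[R]_p,
         (forall i, 0 <= d 0 i <= 1) -> Pd_stationary P d x &
       forall alpha : {ffun 'I_p -> bool}, Palpha_stationary P alpha x]).
Proof.
have [dif _ _ _ _] := hdiff.
split=> [SA|xmin gcq].
  split=> [C|d|alpha].
  - exact: Aalpha_stationary_crossing.
  - exact: Aalpha_Pd_stationary.
  - exact: Aalpha_Palpha_stationary.
have SA alpha : Aalpha_stationary P alpha x by exact: GCQ_Aalpha_stationary.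
split=> [C|d|alpha].
- exact: Aalpha_stationary_crossing.
- exact: Aalpha_Pd_stationary.
- exact: Aalpha_Palpha_stationary.
Qed.
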